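(* Let $p$ be a prime, $\lambda\ge1$ an integer, and let $(N,+,\circ)$ be a $\mathbb Z_p(\lambda)$-brace of order a power of $p$. Assume that $\mathrm{rank}_{\mathbb Z}N<\lambda(p-1)$. Then $(N,+)$ and $(N,\circ)$ have the same number of elements of each order. In particular, if $(N,\circ)$ is abelian, then $(N,+)\cong(N,\circ)$ as groups.
   Context: A (left) brace is a set $N$ with two group operations $+$ and $\circ$, with $(N,+)$ abelian, such that $x\circ(y+z)=(x\circ y)-x+(x\circ z)$ for all $x,y,z\in N$. Its gamma function is $x\mapsto\gamma_x$, where $\gamma_x(y)=-x+x\circ y$; each $\gamma_x$ is an automorphism of $(N,+)$. Given a ring $R$, an $R$-brace is a brace $(N,+,\circ)$ such that $(N,+)$ is an $R$-module and every $\gamma_x$ ($x\in N$) is an automorphism of $R$-modules. For a prime $p$ and an integer $\lambda\ge1$, $\mathbb Z_p(\lambda)$ denotes the ring of integers of the unique unramified extension of $\mathbb Q_p$ of degree $\lambda$ contained in a fixed algebraic closure of $\mathbb Q_p$. For a finite abelian group $M$, $\mathrm{rank}_{\mathbb Z}M$ is the number of summands in the decomposition of $(M,+)$ as a direct sum of nonzero indecomposable cyclic groups. *)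

(* Defs.v *)
From HB Require Import structures.
From mathcomp Require Import all_boot all_order all_fingroup all_algebra.
From mathcomp Require Import all_solvable all_field.
From mathcomp Require Import boolp.

Set Implicit Arguments.
Unset Strict Implicit.
Unset Printing Implicit Defensive.

Import Order.TTheory GRing.Theory Num.Theory.

(* Z_p is the inverse limit of the rings Z/p^n: an element is the sequence of
   its canonical residues [r n] modulo p^n; the compatibility condition
   [r n = r n.+1 %% p^n] forces [0 <= r n < p^n].  The proof of primality is a
   (phantom) parameter of the type because Z_p must be an integral domain. *)
Section PadicIntegers.
Local Open Scope ring_scope.

Definition compatible_residues (p : nat) : pred (nat -> int) :=
  fun r => `[< forall n, r n = (r n.+1 %% (p ^ n)%N)%Z >].

Record padic_int (p : nat) (p_pr : prime p) : Type := PadicInt {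
  residue : nat -> int;
  residueP : compatible_residues p residue
}.

Arguments residue {p p_pr} x n : rename.

Variables (p : nat) (p_pr : prime p).

Local Notation pX n := (Posz (p ^ n)).
Local Notation Zp := (padic_int p_pr).

HB.instance Definition _ := [isSub of Zp for @residue p p_pr].
HB.instance Definition _ := [Choice of Zp by <:].

Lemma padic_intP (x y : Zp) :
  (forall n, residue x n = residue y n) <-> x = y.
Proof. by split=> [xy|-> //]; apply/val_inj/funext. Qed.

Lemma pX_dvd n : (pX n %| pX n.+1)%Z.
Proof. by rewrite dvdzE /= expnS dvdn_mull. Qed.

Lemma residueS (x : Zp) n : residue x n = (residue x n.+1 %% pX n)%Z.
Proof. by have /asboolP := residueP x; apply. Qed.

Lemma residue_mod (x : Zp) n : (residue x n %% pX n)%Z = residue x n.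
Proof. by rewrite [in RHS]residueS residueS modz_mod. Qed.

Lemma modz_dvdm a m d : (d %| m)%Z -> ((a %% m)%Z = a %[mod d])%Z.
Proof.
move=> dm; apply/eqP.
by rewrite eqz_mod_dvd /modz addrAC subrr sub0r rpredN dvdz_mull.
Qed.

Lemma modpX_mod n a : ((a %% pX n.+1)%Z %% pX n = a %% pX n)%Z.
Proof. exact/modz_dvdm/pX_dvd. Qed.

Definition coherent (f : nat -> int) :=
  forall n, ((f n.+1 %% pX n) = (f n %% pX n))%Z.

Lemma of_coherent_subproof f :
  coherent f -> compatible_residues p (fun n => (f n %% pX n)%Z).
Proof. by move=> fP; apply/asboolP => n; rewrite modpX_mod fP. Qed.

Definition of_coherent f (fP : coherent f) : Zp :=
  PadicInt p_pr (of_coherent_subproof fP).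

Lemma coherent_const a : coherent (fun=> a).
Proof. by []. Qed.

Lemma coherent_opp (x : Zp) : coherent (fun n => - residue x n).
Proof. by move=> n; rewrite [residue x n]residueS modzNm. Qed.

Lemma coherent_add (x y : Zp) :
  coherent (fun n => residue x n + residue y n).
Proof. by move=> n; rewrite [residue x n]residueS [residue y n]residueS modzDm. Qed.

Lemma coherent_mul (x y : Zp) :
  coherent (fun n => residue x n * residue y n).
Proof. by move=> n; rewrite [residue x n]residueS [residue y n]residueS modzMm. Qed.

Definition padic_const (a : int) := of_coherent (coherent_const a).
Definition padic_opp x := of_coherent (coherent_opp x).
Definition padic_add x y := of_coherent (coherent_add x y).
Definition padic_mul x y := of_coherent (coherent_mul x y).

Lemma padic_addA : associative padic_add.
Proof. by move=> x y z; apply/padic_intP => n /=; rewrite modzDmr modzDml addrA. Qed.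

Lemma padic_addC : commutative padic_add.
Proof. by move=> x y; apply/padic_intP => n /=; rewrite addrC. Qed.

Lemma padic_add0 : left_id (padic_const 0) padic_add.
Proof. by move=> x; apply/padic_intP => n /=; rewrite modzDml add0r residue_mod. Qed.

Lemma padic_addN : left_inverse (padic_const 0) padic_opp padic_add.
Proof. by move=> x; apply/padic_intP => n /=; rewrite modzDml addNr. Qed.

HB.instance Definition _ :=
  GRing.isZmodule.Build Zp padic_addA padic_addC padic_add0 padic_addN.

Lemma padic_mulA : associative padic_mul.
Proof. by move=> x y z; apply/padic_intP => n /=; rewrite modzMmr modzMml mulrA. Qed.

Lemma padic_mulC : commutative padic_mul.
Proof. by move=> x y; apply/padic_intP => n /=; rewrite mulrC. Qed.

Lemma padic_mul1 : left_id (padic_const 1) padic_mul.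
Proof. by move=> x; apply/padic_intP => n /=; rewrite modzMml mul1r residue_mod. Qed.

Lemma padic_mulDl : left_distributive padic_mul padic_add.
Proof.
by move=> x y z; apply/padic_intP => n /=; rewrite modzMml modzDm mulrDl.
Qed.

Lemma padic_1neq0 : padic_const 1 != 0.
Proof.
apply/eqP => /padic_intP /(_ 1)/=; rewrite expn1 mod0z modz_small //.
by rewrite ltz_nat prime_gt1.
Qed.

HB.instance Definition _ := GRing.Zmodule_isComNzRing.Build Zp
  padic_mulA padic_mulC padic_mul1 padic_mulDl padic_1neq0.

Definition padic_unit : pred Zp := fun x => `[< exists y, y * x = 1 >].

Definition padic_inv (x : Zp) : Zp :=
  if pselect (exists y, y * x = 1) is left xV then projT1 (cid xV) else x.

Lemma padic_mulVx : {in padic_unit, left_inverse 1 padic_inv *%R}.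
Proof.
move=> x /asboolP xV; rewrite /padic_inv; case: pselect => // xV'.
exact: projT2 (cid xV').
Qed.

Lemma padic_unitPl (x y : Zp) : y * x = 1 -> padic_unit x.
Proof. by move=> yx; apply/asboolP; exists y. Qed.

Lemma padic_inv_out : {in [predC padic_unit], padic_inv =1 id}.
Proof.
move=> x /negP xNu; rewrite /padic_inv; case: pselect => // xV.
by case: xNu; apply/asboolP.
Qed.

HB.instance Definition _ := GRing.ComNzRing_hasMulInverse.Build Zp
  padic_mulVx padic_unitPl padic_inv_out.

Lemma residue_neq0 (x : Zp) n k :
  residue x n != 0 -> ~~ (pX n %| residue x (n + k))%Z.
Proof.
move=> xn; suff -> : (pX n %| residue x (n + k))%Z = (residue x n == 0) by [].
rewrite (sameP dvdz_mod0P eqP); congr (_ == _).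
elim: k => [|k IHk]; first by rewrite addn0 residue_mod.
rewrite -IHk addnS [residue x (n + k)]residueS modz_dvdm //.
by rewrite dvdzE /= expnD dvdn_mulr.
Qed.

Lemma padic_idomain : GRing.integral_domain_axiom Zp.
Proof.
move=> x y xy0; apply/norP => -[x0 y0].
have nz (z : Zp) : z != 0 -> exists n, residue z n != 0.
  move=> z0; apply: contrapT => zN; move/eqP: z0; apply.
  apply/padic_intP => n; rewrite /= mod0z; apply/eqP/negPn/negP => zn.
  by apply: zN; exists n.
have [n xn] := nz _ x0; have [m ym] := nz _ y0.
have {xn} := residue_neq0 m xn; have {ym} := residue_neq0 n ym.
rewrite [(m + n)%N]addnC; set a := residue x _; set b := residue y _.
have : (pX (n + m) %| a * b)%Z.
  apply/dvdz_mod0P; have /padic_intP/(_ (n + m)%N) /= := xy0.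
  by rewrite mod0z.
have [->|a0] := eqVneq a 0; first by rewrite dvdz0.
have [->|b0] := eqVneq b 0; first by rewrite dvdz0.
rewrite !dvdzE /= abszM !pfactor_dvdn ?muln_gt0 ?absz_gt0 ?a0 ?b0 //.
rewrite lognM ?absz_gt0 // -!ltnNge => nm bm an.
by move: nm; rewrite leqNgt -addSn leq_add // ltnW.
Qed.

HB.instance Definition _ :=
  GRing.ComUnitRing_isIntegral.Build Zp padic_idomain.

End PadicIntegers.

Definition padic (p : nat) (p_pr : prime p) : fieldType :=
  {fraction (padic_int p_pr)}.

Section RingOfIntegers.
Local Open Scope ring_scope.

Variables (p : nat) (p_pr : prime p) (L : fieldExtType (padic p_pr)).

Definition padic_int_embed : {rmorphism padic_int p_pr -> L} :=
  in_alg L \o @FracField.tofrac (padic_int p_pr).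

Definition is_integral : {pred L} := fun x => `[< integralOver padic_int_embed x >].

Lemma is_integral_subring : subring_closed is_integral.
Proof.
split=> [|x y /asboolP xi /asboolP yi|x y /asboolP xi /asboolP yi];
  apply/asboolP; [exact: integral1|exact: integral_sub|exact: integral_mul].
Qed.

HB.instance Definition _ :=
  GRing.isSubringClosed.Build L is_integral is_integral_subring.

Record ring_of_integers : Type :=
  RingOfIntegers { integer_val :> L; integer_valP : integer_val \in is_integral }.

HB.instance Definition _ := [isSub for integer_val].
HB.instance Definition _ := [Choice of ring_of_integers by <:].
HB.instance Definition _ := [SubChoice_isSubComNzRing of ring_of_integers by <:].

(* L / Q_p has ramification index 1: the maximal ideal of the local ring O_L,
   i.e. its set of non-units, is p O_L.  The residue field of Q_p is finite,
   hence perfect, so that separability of the residue extension is automatic.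
   Up to isomorphism Q_p has a unique unramified extension L of each degree
   lambda >= 1, and its ring of integers is Z_p(lambda). *)
Definition unramified : Prop :=
  forall x : ring_of_integers,
    ~ (exists y, x * y = 1) <-> exists y, x = p%:R * y.

End RingOfIntegers.

Section Braces.
Local Open Scope ring_scope.

Record brace (N : zmodType) := Brace {
  circ : N -> N -> N;
  circ1 : N;
  circV : N -> N;
  circA : associative circ;
  circ1x : left_id circ1 circ;
  circVx : left_inverse circ1 circV circ;
  circD : forall x y z, circ x (y + z) = circ x y - x + circ x z
}.

Definition gamma (N : zmodType) (B : brace N) (x y : N) : N := - x + circ B x y.

Definition module_brace (R : pzRingType) (N : lmodType R) (B : brace N) : Prop :=
  forall x, linear (gamma B x) /\ bijective (gamma B x).

End Braces.

(* The carrier of (N, o); the canonical group structure on the finite module N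
   itself is the additive one. *)
Definition circ_group (N : finZmodType) (B : brace N) : Type := N.

Section CircGroup.
Variables (N : finZmodType) (B : brace N).
HB.instance Definition _ := Finite.on (circ_group B).
HB.instance Definition _ := Finite_isGroup.Build (circ_group B)
  (@circA _ B) (@circ1x _ B) (@circVx _ B).
End CircGroup.

Section Rank.
Local Open Scope group_scope.

Definition indecomposable (gT : finGroupType) (G : {group gT}) : Prop :=
  G :!=: 1 /\ forall A B : {group gT}, A \x B = G -> A :=: 1 \/ B :=: 1.

(* G is an internal direct sum of r nonzero indecomposable cyclic subgroups; for
   G finite abelian such an r exists and is unique (Krull-Schmidt). *)
Definition has_rank (gT : finGroupType) (G : {group gT}) (r : nat) : Prop :=
  exists b : seq gT,
    [/\ size b = r, \big[dprod/1]_(x <- b) <[x]> = G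
      & forall x, x \in b -> indecomposable <[x]> ].

End Rank.

(* Main.v *)
From HB Require Import structures.
Require Import Defs.
From mathcomp Require Import all_boot all_order all_fingroup all_algebra.
From mathcomp Require Import all_solvable all_field.
From mathcomp Require Import boolp ring.

(** Write O for the ring of integers of L. The two groups do not merely have the
same order statistics: every single x has the same order in (N, +) and in
(N, o). The second assertion follows, since a finite abelian p-group is
determined by how many elements it has of each order.

Since x o y = x + gamma_x(y), the n-th power of x in (N, o) is the geometric sum
(1 + g + ... + g^(n-1)) applied to x, where g = gamma_x is O-linear of p-power
order. So N is viewed as a module over the commutative ring S = O[X], with X
acting as g, and everything reduces to comparing the elements
1 + X + ... + X^(p^e - 1) and p^e of S as operators on N
([geometric_sum_eq0]). The former is a product of factors
T = 1 + Y + ... + Y^(p-1) with Y = X^(p^j), and with d = Y - 1 one has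
T = p (1 + d a) + d^(p-1) for some a in S. The operator d is nilpotent on N.

The rank bound enters by showing d^(p-2) M <= p M for each submodule M
([nilpotent_pow_sub]). Otherwise the images of the d^i M in M / p M form a chain
with p - 1 nonzero factors. A nonzero O-module killed by p contains a copy of the
residue field O / p, hence at least p^lambda elements, so that
|M / p M| >= p^(lambda (p-1)); but |M / p M| = |M[p]| <= |N[p]| <= p^r.
Given this inclusion, d^(p-1) M <= p d M, and Nakayama's lemma for the nilpotent
d yields T M = p M, whence (1 + X + ... + X^(p^e - 1)) M = p^e M for all
submodules M. Taking for M the kernel of either operator shows that both
operators have the same kernel, i.e. x^(p^e) is trivial in (N, o) exactly when it
is in (N, +).

The non-units of O form the ideal p O, so O / p is indeed a field. It has at
least p^lambda elements because of [dim_le_generators_mod_p]: if e_1, ..., e_m generate O modulo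
p as a group, then expanding elements of O digit by digit shows that they generate
O over Z_p, because the intersection of the p^n O is zero; as L = Q_p O, they
span L over Q_p and lambda <= m. *)

Set Implicit Arguments.
Unset Strict Implicit.
Unset Printing Implicit Defensive.

Import GRing.Theory.

(** * Digit expansions in Z_p *)

Section PadicDigits.
Local Open Scope ring_scope.

Variables (p : nat) (p_pr : prime p).
Local Notation Zp := (padic_int p_pr).
Local Notation pX n := (Posz (p ^ n)).

Lemma residue_add (x y : Zp) n :
  residue (x + y) n = ((residue x n + residue y n) %% pX n)%Z.
Proof. by []. Qed.

Lemma residue_mul (x y : Zp) n :
  residue (x * y) n = ((residue x n * residue y n) %% pX n)%Z.
Proof. by []. Qed.

Lemma residue_nat m n : residue (m%:R : Zp) n = (m%:Z %% pX n)%Z.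
Proof.
elim: m => [|m IHm]; first by [].
by rewrite mulrSr residue_add IHm modzDm -addn1 PoszD.
Qed.

Lemma residue0 (x : Zp) : residue x 0 = 0.
Proof. by rewrite residueS modz1. Qed.

Definition digit_sum (c : nat -> nat) (n : nat) : int :=
  \sum_(i < n) ((c i * p ^ i)%N)%:Z.

Lemma coherent_digit_sum c : coherent p (digit_sum c).
Proof.
move=> n; rewrite /digit_sum big_ord_recr /= PoszM addrC mulrC.
by rewrite -modzDml modzMr add0r.
Qed.

(** Digits c i greater than p - 1 are allowed, since partial sums only matter modulo
p^n. *)
Definition padic_series c : Zp := of_coherent p_pr (coherent_digit_sum c).

(** Peeling off the first digit is the only property of the expansions that
is used: it turns convergence into an exact recursion. *)
Lemma padic_seriesS c :
  padic_series c = (c 0%N)%:R + p%:R * padic_series (fun n => c n.+1).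
Proof.
apply/padic_intP => n.
rewrite residue_add residue_mul !residue_nat /= modzMmr modzMml modzDm.
case: n => [|n]; first by rewrite !modz1.
have -> : digit_sum c n.+1 = (c 0%N)%:Z + p%:Z * digit_sum (fun n => c n.+1) n.
  rewrite /digit_sum big_ord_recl /= expn0 muln1; congr (_ + _).
  rewrite big_distrr /=; apply: eq_bigr => i _.
  by rewrite /bump /= add1n -PoszM expnS mulnCA.
rewrite [in RHS]/digit_sum big_ord_recr /= -/(digit_sum _ n) mulrDr addrA addrC.
by rewrite addrC -PoszM mulnCA -expnS PoszM addrC modzMDl.
Qed.

Lemma padic_divp (x : Zp) : residue x 1 = 0 -> exists y, x = p%:R * y.
Proof.
move=> x1.
have dvd n : (p %| residue x n.+1)%Z.
  elim: n => [|n IHn]; first by rewrite x1 dvdz0.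
  move: IHn; rewrite [residue x n.+1]residueS; set a := residue x n.+2.
  move=> pr; rewrite (divz_eq a (pX n.+1)) rpredD // dvdz_mull //.
  by rewrite expnS dvdzE /= dvdn_mulr.
pose f n := (residue x n.+1 %/ p)%Z.
have p0 : (p : int) != 0 by rewrite -lt0n prime_gt0.
have fP n : residue x n.+1 = p%:Z * f n.
  by rewrite mulrC divzK.
have co : coherent p f.
  move=> n; have := residueS x n.+1; rewrite !fP expnS PoszM -mulz_modr ?ltz_nat ?prime_gt0 //.
  by move/(mulfI p0)=> ->; rewrite modz_mod.
exists (of_coherent p_pr co); apply/padic_intP => n.
rewrite residue_mul residue_nat /= modzMmr modzMml -fP.
exact: residueS.
Qed.

(** A nonzero p-adic integer is a power of p times a unit. The unit appears only
through a multiple of the form 1 + p t, which spares inverting it: a Bezout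
relation for the first nonzero residue suffices. *)
Lemma padic_neq0 (a : Zp) : a != 0 ->
  exists s v t, a * v = p%:R ^+ s * (1 + p%:R * t).
Proof.
move=> a0; have [n an] : exists n, residue a n != 0.
  apply: contrapT => an; case/eqP: a0; apply/padic_intP => n.
  by rewrite /= mod0z; apply/eqP/negPn/negP => h; apply: an; exists n.
elim: n a an {a0} => [|n IHn] a; first by rewrite residue0 eqxx.
have [/padic_divp [b ->] abn|a1 _] := eqVneq (residue a 1) 0.
  have [|s [v [t e]]] := IHn b; last first.
    by exists s.+1, v, t; rewrite -mulrA e exprS mulrA.
  apply: contra abn => /eqP bn.
  rewrite residue_mul residue_nat modzMml.
  rewrite (divz_eq (residue b n.+1) (pX n)) -residueS bn addr0.
  by rewrite mulrCA -PoszM -expnS modzMl.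
set c := residue a 1 in a1.
have c0 : (0 <= c)%R by rewrite /c -residue_mod modz_ge0 // expn1 -lt0n prime_gt0.
have cE : c = `|c|%N :> int by rewrite gez0_abs.
have cp : coprime `|c| p.
  rewrite coprime_sym prime_coprime //; apply: contra a1 => pc.
  rewrite /c -residue_mod -/c expn1; apply/eqP/dvdz_mod0P.
  by rewrite dvdzE.
have [b bE] : exists b, a - `|c|%:R = p%:R * b.
  apply: padic_divp; rewrite residue_add.
  have -> : residue (- (`|c|%N%:R : Zp)) 1 = ((- (`|c|%N)%:Z) %% pX 1)%Z.
    by rewrite -[LHS]/((- residue (`|c|%N%:R : Zp) 1) %% pX 1)%Z residue_nat modzNm.
  by rewrite modzDmr -cE -/c subrr mod0z.
(* u is an inverse modulo p of the first residue c of a *)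
have [u [w uw]] : exists u w, (u * `|c| = w * p + 1)%N.
  have := @egcdnP `|c|%N p; case: egcdnP => // [|u w e _ _]; first by rewrite absz_gt0.
  by exists u, w; rewrite e; move: cp; rewrite /coprime => /eqP ->.
exists 0%N, u%:R, (b * u%:R + w%:R); rewrite expr0 mul1r.
have -> : a = `|c|%:R + p%:R * b by rewrite -bE addrC subrK.
rewrite mulrDl -natrM [in LHS]mulnC uw natrD natrM.
ring.
Qed.

End PadicDigits.

(** * The residue ring of an unramified extension *)

Section UnramifiedIntegers.
Local Open Scope ring_scope.

(** If q has degree n and leading coefficient a, then a^(n-1) q(X / a) is monic
with coefficients in A; it has the root a y. *)
Lemma integral_lead_coef_mul (A : comNzRingType) (K : fieldType)
    (phi : {rmorphism A -> K}) (q : {poly A}) (y : K) :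
  (1 < size q)%N -> root (map_poly phi q) y ->
  integralOver phi (phi (lead_coef q) * y).
Proof.
move=> q_gt1 qy; set a := lead_coef q; set m := (size q).-2.
have szq : size q = m.+2 by rewrite /m; case: (size q) q_gt1 => [|[]].
pose f := \poly_(i < m.+1) (a ^+ (m - i) * q`_i) + 'X^(m.+1).
exists f.
  rewrite monicE lead_coefDr ?lead_coefXn //.
  by rewrite size_polyXn ltnS size_poly.
rewrite rootE rmorphD /= map_polyXn hornerD hornerXn.
rewrite (_ : _ + _ = phi (a ^+ m) * (map_poly phi q).[y]).
  by rewrite (rootP qy) mulr0.
rewrite (@horner_coef_wide _ m.+1); last first.
  by rewrite (leq_trans (size_poly _ _)) ?size_poly.
rewrite (@horner_coef_wide _ m.+2); last first.
  by rewrite -szq size_poly.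
rewrite [in RHS]big_ord_recr /= mulrDr mulr_sumr.
congr (_ + _); last first.
  rewrite coef_map /= -[m.+1]/(m.+2.-1) -szq -[q`_ _]/a rmorphXn /=.
  by rewrite szq /= exprMn exprSr !mulrA.
apply: eq_bigr => i _; rewrite !coef_map /= coef_poly ltn_ord.
rewrite rmorphM exprMn !mulrA; congr (_ * _).
rewrite -mulrA [phi q`_i * _]mulrC mulrA -rmorphXn -rmorphM -exprD.
by rewrite subnK // -ltnS.
Qed.

Lemma frac_num_den (A : idomainType) (f : {fraction A}) :
  exists2 d : A, d != 0 &
    exists n, FracField.tofrac d * f = FracField.tofrac n.
Proof.
elim/quotW: f => r; exists \d_r; first exact: denom_ratioP.
exists \n_r; rewrite /GRing.mul /=; unlock FracField.tofrac.
rewrite -[LHS]FracField.pi_mul; apply/eqmodP => /=.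
rewrite FracField.equivfE /FracField.mulf /=.
have d0 := denom_ratioP r.
by rewrite !numden_Ratio ?oner_neq0 ?mul1r ?mulr1.
Qed.

Lemma common_denominator (A : idomainType) (q : {poly {fraction A}}) :
  exists2 d : A, d != 0 &
    exists q0, FracField.tofrac d *: q = map_poly (@FracField.tofrac A) q0.
Proof.
elim/poly_ind: q => [|q c [d d0 [q0 dq]]].
  by exists 1; [exact: oner_neq0|exists 0; rewrite map_poly0 scaler0].
have [e e0 [n ec]] := frac_num_den c.
exists (d * e); [exact: mulf_neq0|exists (e *: q0 * 'X + (d * n)%:P)].
rewrite [RHS]rmorphD /= [in RHS]rmorphM /= map_polyX map_polyC /= map_polyZ.
rewrite -dq !rmorphM /= scalerDr scalerAl scalerA [FracField.tofrac e * _]mulrC.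
by rewrite -ec polyCM mulrA -polyCM mul_polyC.
Qed.

Variables (p : nat) (p_pr : prime p) (L : fieldExtType (padic p_pr)).
Local Notation Zp := (padic_int p_pr).
Local Notation O := (ring_of_integers L).
Local Notation embed := (padic_int_embed L).

Lemma embed_eq0 z : (embed z == 0) = (z == 0).
Proof. by rewrite /= scaler_eq0 oner_eq0 orbF tofrac_eq0. Qed.

Lemma embed_integral z : embed z \in is_integral (L := L).
Proof. apply/asboolP; exact: integral_id. Qed.

Definition padic_cst (z : Zp) : O := RingOfIntegers (embed_integral z).

Fact padic_cst_zmod_morphism : zmod_morphism padic_cst.
Proof. by move=> x y; apply: val_inj; rewrite [RHS]rmorphB; apply: (rmorphB embed). Qed.
Fact padic_cst_monoid_morphism : monoid_morphism padic_cst.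
Proof.
split=> [|x y]; apply: val_inj; first exact: (rmorph1 embed).
by rewrite [RHS]rmorphM; apply: (rmorphM embed).
Qed.
HB.instance Definition _ := GRing.isZmodMorphism.Build Zp O padic_cst
  padic_cst_zmod_morphism.
HB.instance Definition _ := GRing.isMonoidMorphism.Build Zp O padic_cst
  padic_cst_monoid_morphism.

Lemma integer_pow_p_reg n : GRing.lreg (p%:R ^+ n : O).
Proof.
have p0 : p%:R != 0 :> L.
  rewrite -(rmorph_nat embed) embed_eq0.
  apply/eqP => /padic_intP/(_ 2); rewrite residue_nat /= mod0z.
  rewrite modz_small ?ltz_nat ?ltn_Pmulr ?prime_gt1 ?prime_gt0 // => -[p0].
  by move: p_pr; rewrite p0.
move=> x y /(congr1 val); rewrite !rmorphM rmorphXn rmorph_nat => xy.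
exact/val_inj/(mulfI (expf_neq0 n p0)).
Qed.

(** The constant coefficient of an equation satisfied by y is a multiple of y;
dividing the equation by a power of X makes that coefficient nonzero. *)
Lemma integer_divides_padic (y : O) : y != 0 ->
  exists2 a, a != 0 & exists w, padic_cst a = y * w.
Proof.
move=> y0; have /asboolP[q q_mon] := integer_valP y.
rewrite (_ : map_poly embed q = map_poly val (map_poly padic_cst q)); last first.
  by rewrite -map_poly_comp.
rewrite rootE horner_map /= -(rmorph0 (val : O -> L)) (inj_eq val_inj) => /eqP.
have {q_mon} := monic_neq0 q_mon.
elim/poly_ind: q => [|q c IHq]; first by rewrite eqxx.
rewrite [map_poly _ _]rmorphD rmorphM /= map_polyX map_polyC /=.
have [->|c0] := eqVneq c 0.
  rewrite addr0 rmorph0 addr0 hornerM hornerX => qX0 /eqP qy0.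
  apply: IHq; first by apply: contraNneq qX0 => ->; rewrite mul0r.
  apply/val_inj; move: qy0; rewrite -(inj_eq val_inj) rmorphM mulf_eq0 /=.
  by rewrite -{2 3}(rmorph0 (val : O -> L)) !(inj_eq val_inj) (negPf y0) orbF => /eqP.
rewrite hornerD hornerM hornerX hornerC => _ /eqP.
rewrite addr_eq0 mulrC => /eqP e.
by exists (- c); [rewrite oppr_eq0|exists (map_poly padic_cst q).[y]; rewrite e rmorphN].
Qed.

(** Clear the denominators of the minimal polynomial of y over Q_p. *)
Lemma integral_padic_multiple (y : L) : exists2 a, a != 0 & embed a * y \in is_integral (L := L).
Proof.
have /polyOver1P[q qE] := minPolyOver 1%AS y.
have := root_minPoly 1%AS y; rewrite qE => qy.
have [d d0 [q0 q0E]] := common_denominator q.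
have sz : size q0 = size (minPoly 1%AS y).
  rewrite qE size_map_poly -(size_scale q (a := FracField.tofrac d)) ?tofrac_eq0 //.
  rewrite q0E size_map_inj_poly ?rmorph0 //.
  by move=> a b /eqP; rewrite tofrac_eq => /eqP.
exists (lead_coef q0).
  by rewrite lead_coef_eq0 -size_poly_gt0 sz size_minPoly.
apply/asboolP/integral_lead_coef_mul; first by rewrite sz size_minPoly.
rewrite map_poly_comp -q0E map_polyZ rootZ //.
by rewrite /= scaler_eq0 tofrac_eq0 (negPf d0) oner_eq0.
Qed.

Hypothesis L_unr : unramified L.

(** The element p = p * 1 lies in p O, hence is not a unit. *)
Lemma p_nonunit (y : O) : p%:R * y != 1.
Proof.
apply/eqP => e; have [_ H] := L_unr p%:R.
by apply: H; [exists 1; rewrite mulr1 | exists y].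
Qed.

(** A nonzero y divides some nonzero a in Z_p, and a divides some p^s (1 + p t). If y
were divisible by p^(s+1), cancelling p^s would make p divide 1 + p t, hence 1. *)
Lemma integers_separated (y : O) :
  (forall n, exists t, y = p%:R ^+ n * t) -> y = 0.
Proof.
move=> ydiv; apply/eqP/negPn/negP => /integer_divides_padic[a a0 [w aw]].
have [s [v [t avt]]] := padic_neq0 a0; have [u yu] := ydiv s.+1.
have /eqP[] := p_nonunit (u * w * padic_cst v - padic_cst t).
have := congr1 padic_cst avt.
rewrite !rmorphM rmorphXn rmorphD rmorph1 rmorphM /= !rmorph_nat aw yu exprSr.
rewrite -!mulrA => /integer_pow_p_reg e.
by rewrite mulrBr e addrK.
Qed.

(** Iterating x = sum c_i e_i + p y on the remainder y produces the digits of the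
coefficients z_i. The error x - sum z_i e_i is then divisible by every power
of p. *)
Lemma generators_mod_p_span (e : seq O) :
  (forall x : O, exists (c : nat -> nat) y,
     x = \sum_(i < size e) (c i)%:R * e`_i + p%:R * y) ->
  forall x, exists z : nat -> Zp, x = \sum_(i < size e) padic_cst (z i) * e`_i.
Proof.
move=> gen x.
have [C /choice[Y CY]] := choice gen.
pose z (x : O) i : Zp := padic_series p_pr (fun n => C (iter n Y x) i).
(* the error of the approximation of x by the sum built from its digits *)
pose D x := x - \sum_(i < size e) padic_cst (z x i) * e`_i.
have DE x0 : D x0 = p%:R * D (Y x0).
  rewrite /D {1}(CY x0) mulrBr mulr_sumr addrAC -sumrB addrC; congr (_ + _).
  rewrite -sumrN; apply: eq_bigr => i _.
  rewrite /z padic_seriesS rmorphD rmorphM !rmorph_nat /=.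
  have -> : (fun n => C (Y (iter n Y x0)) i) = (fun n => C (iter n Y (Y x0)) i).
    by apply/funext => n; rewrite -iterS iterSr.
  by rewrite mulrDl opprD addrA subrr add0r mulrA.
exists (z x); apply/eqP; rewrite -subr_eq0; apply/eqP/integers_separated => n.
exists (D (iter n Y x)); rewrite -/(D x).
by elim: n {gen} => [|n IHn]; rewrite ?mul1r // IHn iterS exprSr -mulrA -DE.
Qed.

Lemma dim_le_generators_mod_p (e : seq O) :
  (forall x : O, exists (c : nat -> nat) y,
     x = \sum_(i < size e) (c i)%:R * e`_i + p%:R * y) ->
  (\dim {:L} <= size e)%N.
Proof.
move=> /generators_mod_p_span gen.
rewrite -(size_map (val : O -> L) e); apply: leq_trans (dim_span _).
apply/dimvS/subvP => y _; have [a a0 ay] := integral_padic_multiple y.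
have [z] := gen (RingOfIntegers ay).
move/(congr1 (val : O -> L)); rewrite rmorph_sum /= => ayE.
have -> : y = (FracField.tofrac a)^-1 *: (embed a * y).
  by rewrite /= -scalerAl mul1r scalerA mulVf ?tofrac_eq0 // scale1r.
rewrite ayE memvZ // memv_suml // => i _.
rewrite -scalerAl mul1r memvZ // memv_span //.
by rewrite map_f ?mem_nth.
Qed.

End UnramifiedIntegers.

(** * Geometric sums and binomials modulo p *)

Section GeometricSums.
Local Open Scope ring_scope.

Variables (S : comNzRingType) (p : nat) (p_pr : prime p).
Implicit Types x y d : S.

Lemma geometric_sum_shift d n :
  \sum_(i < n) (1 + d) ^+ i = \sum_(i < n) 'C(n, i.+1)%:R * d ^+ i.
Proof.
elim: n => [|n IHn]; first by rewrite !big_ord0.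
under [RHS]eq_bigr => i _ do rewrite binS natrD mulrDl.
rewrite [LHS]big_ord_recr big_split /= IHn; congr (_ + _).
  by rewrite [RHS]big_ord_recr /= bin_small // mul0r addr0.
rewrite exprDn; apply: eq_bigr => i _.
by rewrite expr1n mul1r mulr_natl.
Qed.

(** The binomials 'C(p, i) with 0 < i < p are divisible by p, and the constant term
is exactly p: this is why the cofactor of p is 1 modulo y - 1. *)
Lemma geometric_sum_prime y : exists a,
  \sum_(i < p) y ^+ i = p%:R * (1 + (y - 1) * a) + (y - 1) ^+ (p - 1).
Proof.
have -> : y = 1 + (y - 1) by rewrite addrC subrK.
rewrite geometric_sum_shift addrAC subrr add0r; set d := y - 1.
case: p p_pr => [|[|n]] // pr; rewrite subn1 big_ord_recr /= binn mul1r.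
exists (\sum_(i < n) ('C(n.+2, i.+2) %/ n.+2)%:R * d ^+ i); congr (_ + _).
rewrite big_ord_recl /= bin1 mulr1 mulrDr mulr1 mulr_sumr mulr_sumr.
congr (_ + _); apply: eq_bigr => i _; rewrite /bump /= add1n.
rewrite -{1}(@divnK n.+2 'C(n.+2, i.+2)); first by rewrite natrM exprS; ring.
by rewrite prime_dvd_bin //= !ltnS.
Qed.

Lemma geometric_sum_mul x m n :
  \sum_(i < m * n) x ^+ i = (\sum_(j < n) (x ^+ m) ^+ j) * \sum_(i < m) x ^+ i.
Proof.
elim: n => [|n IHn]; first by rewrite muln0 !big_ord0 mul0r.
rewrite mulnSr big_split_ord big_ord_recr /= IHn mulrDl.
congr (_ + _); rewrite mulr_sumr; apply: eq_bigr => i _.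
by rewrite exprD exprM.
Qed.

Lemma exprD_mod x b n : exists c, (x + p%:R * b) ^+ n = x ^+ n + p%:R * c.
Proof.
elim: n => [|n [c IHn]]; first by exists 0; rewrite mulr0 addr0.
by exists (b * x ^+ n + (x + p%:R * b) * c); rewrite exprS IHn exprS; ring.
Qed.

Lemma exprD_prime x y : exists b, (x + y) ^+ p = x ^+ p + y ^+ p + p%:R * b.
Proof.
rewrite exprDn; case: p p_pr => // n pr.
exists (\sum_(i < n) x ^+ (n - i) * y ^+ i.+1 * ('C(n.+1, i.+1) %/ n.+1)%:R).
rewrite big_ord_recr big_ord_recl /= bin0 binn subnn subn0 !expr0 mulr1 mul1r.
rewrite addrAC; congr (_ + _ + _); rewrite mulr_sumr; apply: eq_bigr => i _.
rewrite /bump /= add1n subSS -{1}(@divnK n.+1 'C(n.+1, i.+1)).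
  by rewrite -mulr_natr natrM; ring.
by rewrite prime_dvd_bin //= ltnS.
Qed.

Lemma exprD_prime_pow d s :
  exists b, (1 + d) ^+ (p ^ s) = 1 + d ^+ (p ^ s) + p%:R * b.
Proof.
elim: s => [|s [b IHs]]; first by exists 0; rewrite mulr0 addr0.
rewrite expnSr !exprM IHs.
have [c ->] := exprD_mod (1 + d ^+ (p ^ s)) b p.
have [e ->] := exprD_prime 1 (d ^+ (p ^ s)).
by exists (e + c); rewrite expr1n; ring.
Qed.

End GeometricSums.

(** * Nilpotent operators on finite modules *)

Section FiniteModules.
Local Open Scope ring_scope.

Variables (S : comNzRingType) (N : finLmodType S).
Implicit Types (M A B : {set N}) (a d y : S).

Definition scaled a M : {set N} := [set a *: u | u in M].
Definition scaled_sum d M A : {set N} := [set d *: u + v | u in M, v in A].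

Lemma submod_scale M a u : submod_closed M -> u \in M -> a *: u \in M.
Proof. by move=> [M0 MD] Mu; rewrite -[_ *: _]addr0; apply: MD. Qed.

Lemma submod_add M u v : submod_closed M -> u \in M -> v \in M -> u + v \in M.
Proof. by move=> [M0 MD] Mu Mv; rewrite -[u]scale1r; apply: MD. Qed.

Lemma scaled_submod a M : submod_closed M -> submod_closed (scaled a M).
Proof.
move=> [M0 MD]; split=> [|b _ _ /imsetP[u Mu ->] /imsetP[v Mv ->]].
  by apply/imsetP; exists 0; rewrite ?scaler0.
apply/imsetP; exists (b *: u + v); first exact: MD.
by rewrite scalerDr !scalerA mulrC.
Qed.

Lemma scaled_sub a M : submod_closed M -> scaled a M \subset M.
Proof. by move=> sM; apply/subsetP => _ /imsetP[u Mu ->]; apply: submod_scale. Qed.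

Lemma scaled_comp a b M : scaled (a * b) M = scaled a (scaled b M).
Proof.
rewrite /scaled -imset_comp; apply: eq_imset => u /=.
by rewrite scalerA.
Qed.

Lemma scaled_sum_submod d M A :
  submod_closed M -> submod_closed A -> submod_closed (scaled_sum d M A).
Proof.
move=> [M0 MD] [A0 AD].
split=> [|b _ _ /imset2P[u v Mu Av ->] /imset2P[u' v' Mu' Av' ->]].
  by apply/imset2P; exists 0 0; rewrite ?scaler0 ?addr0.
apply/imset2P; exists (b *: u + u') (b *: v + v'); [exact: MD|exact: AD|].
by rewrite !scalerDr !scalerA mulrC addrACA.
Qed.

Lemma torsion_submod a : submod_closed [set x : N | a *: x == 0].
Proof.
split=> [|b u v]; rewrite !inE ?scaler0 // => /eqP u0 /eqP v0.
by rewrite scalerDr scalerA mulrC -scalerA u0 v0 scaler0 addr0.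
Qed.

(** Iterating M <= d M + A gives M <= d^n M + A = A. *)
Lemma nilpotent_nakayama d n M A :
    (forall x : N, d ^+ n *: x = 0) -> submod_closed A ->
  M \subset scaled_sum d M A -> M \subset A.
Proof.
move=> dn sA sub.
have step m u : u \in M -> exists2 v, v \in M & u - d ^+ m *: v \in A.
  elim: m u => [|m IHm] u Mu; first by exists u; rewrite // scale1r subrr; case: sA.
  have /imset2P[v w Mv Aw ->] := subsetP sub u Mu.
  have [v' Mv' Av'] := IHm v Mv; exists v' => //.
  rewrite exprS -scalerA addrAC -scalerBr.
  exact: submod_add (submod_scale _ _ _) _.
apply/subsetP => u Mu; have [v _] := step n u Mu.
by rewrite dn subr0.
Qed.

Section PrimePower.

Variables (p : nat) (p_pr : prime p).

(** Modulo p, the p^s-th power of y - 1 is y^(p^s) - 1, which kills N; so that power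
acts as a multiple of p, and p is nilpotent on N. *)
Lemma unipotent_nilpotent k y s :
    (forall x : N, (p ^ k)%:R *: x = 0) -> (forall x : N, y ^+ (p ^ s) *: x = x) ->
  forall x : N, (y - 1) ^+ (p ^ s * k) *: x = 0.
Proof.
move=> pk0 ys; set d := y - 1.
have [b yE] := exprD_prime_pow p_pr d s.
have dE (x : N) : d ^+ (p ^ s) *: x = (- (p%:R * b)) *: x.
  have := ys x; rewrite (_ : y = 1 + d); last by rewrite addrC subrK.
  rewrite yE !scalerDl scale1r -addrA => /(canRL (addKr x)) /eqP.
  by rewrite addNr addr_eq0 scaleNr => /eqP.
have pow m (x : N) : d ^+ (p ^ s * m) *: x = (- (p%:R * b)) ^+ m *: x.
  elim: m x => [|m IHm] x; first by rewrite muln0.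
  by rewrite mulnSr exprD -scalerA dE IHm scalerA -exprSr.
by move=> x; rewrite pow -mulrN exprMn -natrX -scalerA pk0.
Qed.

(** The fibres of multiplication by p on M are cosets of the p-torsion of M. *)
Lemma card_submod_le M :
  (#|M| <= #|scaled p%:R M| * #|[set x : N | p%:R *: x == 0%R]|)%N.
Proof.
rewrite -sum1_card (partition_big_imset (fun u => p%:R *: u)) /=.
rewrite -sum_nat_const; apply: leq_sum => _ /imsetP[u Mu ->].
rewrite sum1_card -(card_in_imset (f := fun v => v - u)); last first.
  by move=> v w _ _ /addIr.
apply/subset_leq_card/subsetP => _ /imsetP[v /andP[_ /eqP pv] ->].
by rewrite inE scalerBr pv subrr.
Qed.

(* The two hypotheses abstract what is needed of the ring of scalars and of the
   rank of N: q is a lower bound for the order of the residue field. *)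
Variable (q : nat).
Hypothesis card_step : forall A B, submod_closed A -> submod_closed B ->
  A \proper B -> scaled p%:R B \subset A -> (q * #|A| <= #|B|)%N.
Hypothesis torsion_lt : (#|[set x : N | p%:R *: x == 0%R]| < q ^ (p - 1))%N.

(** The chain M > d M + A > d (d M + A) + A > ... strictly decreases until it
reaches A, and each step costs a factor q. Hence either it stops early, or M is
large compared to A. *)
Lemma long_filtration_card d n m M A :
    (forall x : N, d ^+ n *: x = 0) -> submod_closed M -> submod_closed A ->
    A \subset M -> scaled p%:R M \subset A ->
  scaled (d ^+ m) M \subset A \/ (q ^ m.+1 * #|A| <= #|M|)%N.
Proof.
move=> dn; elim: m M => [|m IHm] M sM sA AM pMA.
  have [MA|MA] := boolP (M \subset A); [left|right].
    by apply/subsetP => _ /imsetP[u Mu ->]; rewrite scale1r (subsetP MA).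
  by rewrite expn1 card_step // properE AM.
have [MA|MA] := boolP (M \subset A).
  by left; apply: subset_trans MA; apply: scaled_sub.
pose M1 := scaled_sum d M A.
have sM1 : submod_closed M1 by apply: scaled_sum_submod.
have M1M : M1 \proper M.
  rewrite properE; apply/andP; split.
    apply/subsetP => _ /imset2P[u v Mu Av ->]; apply: submod_add => //.
      exact: submod_scale.
    exact: subsetP AM v Av.
  by apply: contra MA; apply: nilpotent_nakayama dn sA.
have AM1 : A \subset M1.
  apply/subsetP => v Av; apply/imset2P; exists 0 v => //; first by case: sM.
  by rewrite scaler0 add0r.
have pM1 : scaled p%:R M1 \subset A.
  by apply: subset_trans (imsetS _ (proper_sub M1M)) pMA.
have [dM1|cM1] := IHm M1 sM1 sA AM1 pM1; [left|right].
  apply/subsetP => _ /imsetP[u Mu ->]; apply: (subsetP dM1).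
  apply/imsetP; exists (d *: u); last by rewrite scalerA -exprSr.
  apply/imset2P; exists u 0; rewrite ?addr0 //; by case: sA.
rewrite expnS -mulnA (leq_trans (leq_mul (leqnn q) cM1)) // card_step //.
exact: subset_trans pMA AM1.
Qed.

(** Were this false, the filtration of M / p M would have p - 1 steps, making M / p M
larger than the p-torsion of N, while it has as many elements as that of M. *)
Lemma nilpotent_pow_sub d n M :
    (forall x : N, d ^+ n *: x = 0) -> submod_closed M ->
  scaled (d ^+ (p - 2)) M \subset scaled p%:R M.
Proof.
move=> dn sM; have sp := scaled_submod p%:R sM.
have [//|cM] := long_filtration_card (p - 2) dn sM sp (scaled_sub _ sM) (subxx _).
have p2 : (p - 2).+1 = (p - 1)%N by rewrite -subSn ?prime_gt1.
have pM_gt0 : (0 < #|scaled p%:R M|)%N.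
  by apply/card_gt0P; exists 0; case: sp.
have := leq_trans cM (card_submod_le M).
by rewrite p2 mulnC leq_pmul2l // leqNgt torsion_lt.
Qed.

(** With d = y - 1 the sum acts as u |-> p u + d p (a u + v), where d^(p-2) u = p v.
So it maps M into p M, and p M <= T M + d (p M), where the last term is absorbed
by nilpotency. *)
Lemma scaled_geometric_sum_prime y n M :
    (forall x : N, (y - 1) ^+ n *: x = 0) -> submod_closed M ->
  scaled (\sum_(i < p) y ^+ i) M = scaled p%:R M.
Proof.
move=> dn sM; set T := \sum_(i < p) y ^+ i; set d := y - 1 in dn.
have [a TE] := geometric_sum_prime p_pr y; rewrite -/T -/d in TE.
have tail u : u \in M -> exists2 v, v \in M & d ^+ (p - 1) *: u = d *: (p%:R *: v).
  move=> Mu; have : d ^+ (p - 2) *: u \in scaled p%:R M.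
    by apply: (subsetP (nilpotent_pow_sub dn sM)); apply: imset_f.
  case/imsetP=> v Mv e; exists v => //.
  by rewrite -e scalerA -exprS -subSn ?prime_gt1.
have TuE (u v : N) : d ^+ (p - 1) *: u = d *: (p%:R *: v) ->
    T *: u = p%:R *: u + d *: (p%:R *: (a *: u + v)).
  move=> e; rewrite TE scalerDl e mulrDr mulr1 scalerDl -addrA; congr (_ + _).
  rewrite !scalerDr; congr (_ + _); rewrite !scalerA; congr (_ *: _); ring.
apply/eqP; rewrite eqEsubset; apply/andP; split.
  apply/subsetP => _ /imsetP[u Mu ->]; have [v Mv /TuE ->] := tail u Mu.
  apply/imsetP; exists (u + d *: (a *: u + v)).
    by do ?[assumption | apply: submod_add | apply: submod_scale].
  by rewrite [RHS]scalerDr !scalerA mulrC.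
apply: (nilpotent_nakayama dn); first exact: scaled_submod.
apply/subsetP => _ /imsetP[u Mu ->]; have [v Mv /TuE Tu] := tail u Mu.
apply/imset2P; exists (p%:R *: (- (a *: u + v))) (T *: u).
- apply: imset_f; rewrite -scaleN1r.
  by do ?[assumption | apply: submod_add | apply: submod_scale].
- exact: imset_f.
- by rewrite Tu addrC scalerN scalerN addrK.
Qed.

Lemma scaled_geometric_sum k y s e M :
    (forall x : N, (p ^ k)%:R *: x = 0) -> (forall x : N, y ^+ (p ^ s) *: x = x) ->
  submod_closed M -> scaled (\sum_(i < p ^ e) y ^+ i) M = scaled (p ^ e)%:R M.
Proof.
move=> pk0 ys; elim: e M => [|e IHe] M sM.
  by rewrite big_ord1 expr0.
rewrite expnSr geometric_sum_mul natrM [(p ^ e)%:R * _]mulrC !scaled_comp IHe //.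
apply: (@scaled_geometric_sum_prime _ (p ^ s * k)); last exact: scaled_submod.
apply: unipotent_nilpotent => // x.
rewrite -exprM mulnC exprM.
elim: (p ^ e)%N => [|m IHm]; first by rewrite scale1r.
by rewrite exprSr -scalerA ys.
Qed.

(** The kernel M of either operator is a submodule; its image under that operator is
zero, hence so is its image under the other one. *)
Lemma geometric_sum_eq0 k y s e (x : N) :
    (forall x : N, (p ^ k)%:R *: x = 0) -> (forall x : N, y ^+ (p ^ s) *: x = x) ->
  ((\sum_(i < p ^ e) y ^+ i) *: x == 0) = ((p ^ e)%:R *: x == 0).
Proof.
move=> pk0 ys; set T := \sum_(i < _) _.
have eqTP M : submod_closed M -> scaled T M = scaled (p ^ e)%:R M.
  exact: scaled_geometric_sum pk0 ys.
have tors a b : scaled a [set u : N | a *: u == 0] = scaled b [set u : N | a *: u == 0] ->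
    a *: x == 0 -> b *: x == 0.
  move=> ab ax; have : b *: x \in scaled b [set u : N | a *: u == 0].
    by apply: imset_f; rewrite inE.
  by rewrite -ab => /imsetP[u]; rewrite inE => /eqP -> ->.
apply/idP/idP; apply: tors; first exact/eqTP/torsion_submod.
exact/esym/eqTP/torsion_submod.
Qed.

End PrimePower.
End FiniteModules.

(** * The R[X]-module defined by an endomorphism *)

Section PolynomialAction.
Local Open Scope ring_scope.

Variables (R : comNzRingType) (N : finLmodType R).

(** An alias of N that remembers g, so that it can carry another scalar action. *)
Definition polymod (g : {linear N -> N}) : Type := N.

Variable g : {linear N -> N}.
HB.instance Definition _ := FinRing.Zmodule.on (polymod g).

Definition poly_scale (a : {poly R}) (x : polymod g) : polymod g :=
  \sum_(i < size a) a`_i *: iter i g x.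

Lemma poly_scale_wide n (a : {poly R}) x : (size a <= n)%N ->
  poly_scale a x = \sum_(i < n) a`_i *: iter i g x.
Proof.
move=> le_an; rewrite /poly_scale (big_ord_widen n (fun i => a`_i *: iter i g x)) //.
rewrite big_mkcond; apply: eq_bigr => i _; case: ltnP => // le_ai.
by rewrite nth_default // scale0r.
Qed.

Lemma iter_linear i (x y : N) : iter i g (x + y) = iter i g x + iter i g y.
Proof. by elim: i => //= i ->; rewrite linearD. Qed.

Lemma poly_scaleDr : right_distributive poly_scale +%R.
Proof.
move=> a x y; rewrite /poly_scale -big_split /=; apply: eq_bigr => i _.
by rewrite iter_linear scalerDr.
Qed.

Lemma poly_scaleDl x : {morph poly_scale^~ x : a b / a + b}.
Proof.
move=> a b; pose n := maxn (size a) (size b).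
rewrite !(@poly_scale_wide n) ?leq_maxl ?leq_maxr ?size_polyD //.
by rewrite -big_split /=; apply: eq_bigr => i _; rewrite coefD scalerDl.
Qed.

Lemma poly_scaleC c x : poly_scale c%:P x = c *: (x : N).
Proof. by rewrite (@poly_scale_wide 1) ?size_polyC_leq1 // big_ord1 coefC. Qed.

Lemma poly_scaleMX a x : poly_scale (a * 'X) x = poly_scale a (g x).
Proof.
rewrite (@poly_scale_wide (size a).+1).
  rewrite big_ord_recl coefMX /= scale0r add0r; apply: eq_bigr => i _.
  by rewrite coefMX -iterSr.
have [->|a0] := eqVneq a 0; first by rewrite mul0r size_poly0.
by rewrite size_mulX.
Qed.

Lemma poly_scale_linear a x : poly_scale a (g x) = g (poly_scale a x).
Proof.
rewrite /poly_scale linear_sum; apply: eq_bigr => i _.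
by rewrite linearZ -iterS iterSr.
Qed.

Lemma poly_scaleCM c a x : poly_scale (c%:P * a) x = c *: (poly_scale a x : N).
Proof.
rewrite mul_polyC (@poly_scale_wide (size a)) ?size_scale_leq //.
by rewrite scaler_sumr; apply: eq_bigr => i _; rewrite coefZ scalerA.
Qed.

Lemma poly_scaleA a b x : poly_scale a (poly_scale b x) = poly_scale (a * b) x.
Proof.
elim/poly_ind: a x => [|a c IHa] x.
  by rewrite mul0r /poly_scale size_poly0 !big_ord0.
rewrite poly_scaleDl poly_scaleMX -poly_scale_linear IHa poly_scaleC.
by rewrite mulrDl poly_scaleDl poly_scaleCM mulrAC poly_scaleMX.
Qed.

Lemma poly_scale1 : left_id 1 poly_scale.
Proof. by move=> x; rewrite poly_scaleC scale1r. Qed.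

HB.instance Definition _ := GRing.Zmodule_isLmodule.Build {poly R} (polymod g)
  poly_scaleA poly_scale1 poly_scaleDr poly_scaleDl.

Lemma polymodC c (x : polymod g) : c%:P *: x = c *: (x : N).
Proof. exact: poly_scaleC. Qed.

Lemma polymodX (x : polymod g) : 'X *: x = g x.
Proof. by rewrite -[_ *: _]/(poly_scale _ _) -['X]mul1r poly_scaleMX poly_scaleC scale1r. Qed.

Lemma polymodXn n (x : polymod g) : 'X^n *: x = iter n g x.
Proof.
elim: n => [|n IHn]; first by rewrite scale1r.
by rewrite exprS -scalerA IHn polymodX.
Qed.

End PolynomialAction.

(** * Abelian p-groups are determined by their order statistics *)

Section OrderCounts.
Local Open Scope group_scope.

Lemma card_Ldiv_order (gT : finGroupType) (G : {group gT}) m : 0 < m ->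
  #|'Ldiv_m(G)| = \sum_(d < m.+1 | d %| m) #|[set x in G | #[x] == d]|.
Proof.
move=> m_gt0; rewrite -sum1_card.
(* orders dividing m fit in 'I_m.+1, so inord loses nothing *)
rewrite (partition_big (fun x => inord #[x] : 'I_m.+1) (fun d => d %| m)) /=.
  apply: eq_bigr => d d_m; rewrite sum1_card; apply: eq_card => x.
  rewrite !inE unfold_in /= !inE -order_dvdn; case: (x \in G) => //=.
  have [x_m|x_m] := boolP (#[x] %| m).
    by rewrite -val_eqE /= inordK // ltnS dvdn_leq.
  by apply/esym/eqP => x_d; rewrite x_d d_m in x_m.
move=> x; rewrite !inE -order_dvdn => /andP[_ x_m].
by rewrite inordK // ltnS dvdn_leq.
Qed.

Lemma count_pfactor (p : nat) (s : seq nat) j : all (fun m => p.-nat m) s -> prime p ->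
  count_mem (p ^ j.+1)%N s =
    (count (fun m => j < logn p m) s - count (fun m => j.+1 < logn p m) s)%N.
Proof.
move=> s_p p_pr; apply/eqP; rewrite -(eqn_add2r (count (fun m => j.+1 < logn p m) s)).
rewrite subnK; last by apply: sub_count => m /= /ltnW.
elim: s s_p => //= m s IHs /andP[/p_natP[i ->] /IHs/eqP {}IHs].
rewrite addnACA IHs pfactorK // eqn_add2r eqn_exp2l ?prime_gt1 //.
by case: (ltngtP j.+1 i) => //; rewrite ltnS.
Qed.

(** The counts determine the number of solutions of x^(p^n) = 1, i.e. the orders of
the Omega subgroups; their successive indices count the cyclic factors of order
greater than p^n, whence the type. *)
Lemma isog_order_counts (aT rT : finGroupType) (G : {group aT}) (H : {group rT}) (p : nat) :
    prime p -> p.-group G -> p.-group H -> abelian G -> abelian H ->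
    (forall n, #|[set x in G | #[x] == n]| = #|[set x in H | #[x] == n]|) ->
  G \isog H.
Proof.
move=> p_pr pG pH cGG cHH eqn; rewrite eq_abelian_type_isog //; apply/eqP.
have Ohm_eq n : #|'Ohm_n(G)| = #|'Ohm_n(H)|.
  rewrite (OhmEabelian pG) ?(abelianS (Ohm_sub n G)) //.
  rewrite (OhmEabelian pH) ?(abelianS (Ohm_sub n H)) //.
  by rewrite !card_Ldiv_order ?expn_gt0 ?prime_gt0 //; apply: eq_bigr.
(* number of cyclic factors of order greater than p^n *)
have cnt n (gT : finGroupType) (K : {group gT}) : abelian K ->
    count (fun m => n < logn p m) (abelian_type K) =
    logn p (#|'Ohm_n.+1(K)| %/ #|'Ohm_n(K)|).
  move=> cKK; have [b defK <-] := abelian_structure cKK.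
  by rewrite count_map (count_logn_dprod_cycle _ _ defK) -divgS // Ohm_leq.
have pnat (gT : finGroupType) (K : {group gT}) : p.-group K -> abelian K ->
    all (fun m => p.-nat m) (abelian_type K).
  move=> pK cKK; have [b defK <-] := abelian_structure cKK.
  apply/allP => _ /mapP[x bx ->]; apply: mem_p_elt pK _.
  rewrite -(bigdprodWY defK) mem_gen //; move: bx.
  by case/splitPr => b1 b2; rewrite big_cat big_cons !inE cycle_id orbT.
have geq_trans : transitive geq by move=> y x z /= yx zy; apply: leq_trans zy yx.
have geq_anti : antisymmetric geq.
  by move=> x y; rewrite /= andbC; apply: anti_leq.
apply: (sorted_eq geq_trans geq_anti (abelian_type_sorted G) (abelian_type_sorted H)).
apply/allP => m; rewrite mem_cat => m_t; apply/eqP.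
have [j ->] : exists j, m = (p ^ j.+1)%N.
  have m_gt1 : 1 < m.
    by case/orP: m_t; apply: allP; apply: abelian_type_gt1.
  have /p_natP[[|j] mE] : p.-nat m.
  - by case/orP: m_t; apply: allP; apply: pnat.
  - by rewrite mE in m_gt1.
  - by exists j.
by rewrite !count_pfactor ?pnat // !cnt // !Ohm_eq.
Qed.

End OrderCounts.

(** * The p-torsion and the rank *)

Section Torsion.
Local Open Scope group_scope.

(** For an abelian p-group the rank is the least number of generators. *)
Lemma card_p_torsion (gT : finGroupType) (G : {group gT}) (p : nat) b :
    prime p -> p.-group G -> abelian G ->
    \big[dprod/1]_(x <- b) <[x]> = G ->
  #|[set x in G | x ^+ p == 1]| <= p ^ size b.
Proof.
move=> p_pr pG cGG defG.
have <- : 'Ohm_1(G) = [set x in G | x ^+ p == 1].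
  rewrite (OhmEabelian pG) ?(abelianS (Ohm_sub 1 _)) // expn1.
  by apply/setP => x; rewrite !inE.
rewrite (card_pgroup (pgroupS (Ohm_sub 1 G) pG)) -p_rank_abelian //.
rewrite -(rank_pgroup pG) -grank_abelian // leq_exp2l ?prime_gt1 //.
have genG : <<[set x in b]>> = G.
  apply/eqP; rewrite -(bigdprodWY defG) eqEsubset !gen_subG.
  apply/andP; split.
    apply/subsetP => x; rewrite inE => bx; rewrite mem_gen //.
    by case/splitPr: bx => b1 b2; rewrite big_cat big_cons !inE cycle_id orbT.
  rewrite (big_nth 1) big_mkord; apply/bigcupsP => i _.
  by rewrite cycle_subG mem_gen // inE mem_nth.
rewrite -genG (leq_trans (grank_min _)) // cardsE; exact: card_size.
Qed.

End Torsion.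

(** * Index of submodules over the integers of an unramified extension *)

Section UnramifiedStep.
Local Open Scope ring_scope.

Variables (p : nat) (p_pr : prime p) (L : fieldExtType (padic p_pr)).
Hypothesis L_unr : unramified L.
Local Notation O := (ring_of_integers L).
Variable N : finLmodType O.

Lemma submod_group_set (A : {set N}) : submod_closed A -> group_set A.
Proof.
move=> sA; apply/group_setP; split; first by case: sA.
by move=> x y Ax Ay; apply: submod_add.
Qed.

(** The annihilator in O of a nonzero element of B / A contains p and no unit, so it
is the ideal p O, and B / A contains a copy of O / p. This copy is built inside B,
one dimension at a time: as long as fewer than dim L elements e_i of O have been
chosen, they cannot generate O modulo p, and some x outside their span modulo p
gives an element x b outside the group G generated so far by A and the e_i b,
which enlarges G by a factor at least p. *)
Lemma card_unramified_step k (A B : {set N}) : #|N| = (p ^ k)%N ->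
    submod_closed A -> submod_closed B ->
    A \proper B -> scaled p%:R B \subset A ->
  (p ^ \dim {:L} * #|A| <= #|B|)%N.
Proof.
move=> N_card sA sB /properP[AB [b Bb Ab]] pBA.
have B_group : group_set B := submod_group_set sB.
suff step d : (d <= \dim {:L})%N -> exists (e : seq O) (G : {group N}),
    [/\ size e = d, A \subset G, G \subset B,
        (p ^ d * #|A| <= #|G|)%N &
        forall y, y \in G -> exists c : nat -> nat,
          y - (\sum_(i < d) (c i)%:R * e`_i) *: b \in A].
  have [_ [G [_ _ GB le_G _]]] := step _ (leqnn _).
  exact: leq_trans le_G (subset_leq_card GB).
elim: d => [_|d IHd lt_d].
  exists [::], (Group (submod_group_set sA)); split; rewrite ?mul1n //.
  by move=> y Ay; exists (fun=> 0%N); rewrite big_ord0 scale0r subr0.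
have [e [G [sz_e AG GB le_G Gspan]]] := IHd (ltnW lt_d).
(* fewer than dim L elements cannot generate O modulo p *)
have [x xN] : exists x : O, forall (c : nat -> nat) (y : O),
    x <> \sum_(i < size e) (c i)%:R * e`_i + p%:R * y.
  apply: contrapT => no_x; move: lt_d; rewrite ltnNge -{1}sz_e.
  case/negP; apply: dim_le_generators_mod_p => // x; apply: contrapT => no_c.
  by apply: no_x; exists x => c y xE; apply: no_c; exists c, y.
(* otherwise x - sum c_i e_i maps b into A, so it is a non-unit, i.e. in p O *)
have xbG : x *: b \notin G.
  apply/negP => /Gspan[c]; rewrite -scalerBl; set z := x - _ => Az.
  have [nonunit_p _] := L_unr z; have [|y zE] := nonunit_p.
    case=> z' zz'; case/negP: Ab.
    by rewrite -[b]scale1r -zz' mulrC -scalerA submod_scale.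
  by apply: (xN c y); rewrite sz_e -zE addrC subrK.
pose xb : N := x *: b; pose G' := (G <*> <[xb]>)%G.
have G'E y : y \in G' -> exists2 g, g \in G & exists n, y = g + xb *+ n.
  rewrite /= norm_joinEr; last first.
    by rewrite cents_norm // (sub_abelian_cent2 (FinRing.zmod_abelian [set: N])) ?subsetT.
  by case/mulsgP => g _ Gg /cycleP[n ->] ->; exists g => //; exists n.
have GG' : G \subset G' by apply: joing_subl.
exists (rcons e x), G'; split.
- by rewrite size_rcons sz_e.
- exact: subset_trans GG'.
- have xbB : <[xb]>%g \subset Group B_group by rewrite cycle_subG; apply: submod_scale.
  have := join_subG G <[xb]>%g (Group B_group).
  by rewrite GB xbB.
- rewrite expnS -mulnA (leq_trans (leq_mul (leqnn p) le_G)) //.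
  rewrite -(Lagrange GG') mulnC leq_pmul2l ?cardG_gt0 //.
  have : p.-nat #|G' : G|%g.
    apply: pnat_dvd (dvdn_indexg _ _) _; apply: pnat_dvd (cardSg (subsetT _)) _.
    by rewrite cardsT N_card pnatX pnat_id.
  case/p_natP => -[|j] jE; last by rewrite jE expnS leq_pmulr ?expn_gt0 ?prime_gt0.
  case/negP: xbG; have : G' \subset G by rewrite -indexg_eq1 jE.
  by move/subsetP; apply; rewrite mem_gen // inE cycle_id orbT.
- move=> y /G'E[g /Gspan[c Ac] [n ->]].
  exists (fun i => if (i < d)%N then c i else n); rewrite big_ord_recr /= ltnn.
  rewrite nth_rcons sz_e ltnn eqxx scalerDl.
  rewrite -scalerA scaler_nat opprD addrACA subrr addr0.
  rewrite (eq_bigr (fun i : 'I_d => (c i)%:R * e`_i)) // => i _.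
  by rewrite ltn_ord nth_rcons sz_e ltn_ord.
Qed.

End UnramifiedStep.

(** * Powers and orders in a brace *)

Section BraceGamma.
Local Open Scope ring_scope.

Variables (N : zmodType) (B : brace N).

Lemma circ_gammaE x y : circ B x y = x + gamma B x y.
Proof. by rewrite /gamma addrA subrr add0r. Qed.

Lemma circx0 x : circ B x 0 = x.
Proof.
have := circD B x 0 0; rewrite addr0 -addrA => /esym/(canRL (addKr _)).
by rewrite addNr addrC => /subr0_eq.
Qed.

Lemma circ1_eq0 : circ1 B = 0.
Proof. by rewrite -[LHS]circx0 circ1x. Qed.

Lemma gamma0x z : gamma B 0 z = z.
Proof. by rewrite /gamma -circ1_eq0 circ1x circ1_eq0 oppr0 add0r. Qed.

Lemma gammaM x y z : zmod_morphism (gamma B x) ->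
  gamma B (circ B x y) z = gamma B x (gamma B y z).
Proof.
move=> gB; rewrite {3}/gamma addrC gB /gamma circA.
by rewrite opprD opprK addrACA addNr add0r addrC.
Qed.

End BraceGamma.

Section ModuleBrace.
Local Open Scope ring_scope.

Variables (R : comNzRingType) (N : finLmodType R) (B : brace N).
Hypothesis B_mod : module_brace B.

(** A head constant to which the linear structure of gamma_x can be attached. *)
Definition gamma_map (x : N) : N -> N := gamma B x.
HB.instance Definition _ x :=
  GRing.isLinear.Build R N N *:%R (gamma_map x) (B_mod x).1.

(** From x o y = x + gamma_x(y) by induction on n. *)
Lemma circ_expgE (x : circ_group B) n :
  (x ^+ n)%g = (\sum_(i < n) 'X ^+ i) *: (x : polymod (gamma_map x)) :> N.
Proof.
elim: n => [|n IHn]; first by rewrite big_ord0 scale0r -(circ1_eq0 B).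
have -> : \sum_(i < n.+1) 'X ^+ i = 1 + 'X * \sum_(i < n) 'X ^+ i :> {poly R}.
  rewrite big_ord_recl mulr_sumr; congr (_ + _).
  by apply: eq_bigr => i _; rewrite -exprS.
rewrite scalerDl scale1r -scalerA polymodX expgS.
by rewrite -[LHS]/(circ B x (x ^+ n)%g) circ_gammaE IHn.
Qed.

(** gamma is a morphism from (N, o) to the automorphisms of (N, +). *)
Lemma iter_gamma (x : circ_group B) n y :
  iter n (gamma_map x) y = gamma B (x ^+ n)%g y.
Proof.
elim: n => [|n IHn]; first by rewrite -[(x ^+ 0)%g]/(circ1 B) circ1_eq0 gamma0x.
rewrite iterS IHn expgS -[RHS]/(gamma B (circ B x (x ^+ n)%g) y) gammaM //.
exact: (raddfB (gamma_map x)).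
Qed.

Variables (p : nat) (p_pr : prime p) (k q : nat).
Hypothesis N_card : #|N| = (p ^ k)%N.
Hypothesis card_step : forall A C : {set N}, submod_closed A -> submod_closed C ->
  A \proper C -> scaled p%:R C \subset A -> (q * #|A| <= #|C|)%N.
Hypothesis torsion_lt : (#|[set x : N | (x ^+ p)%g == 1%g]| < q ^ (p - 1))%N.

Lemma circ_expg_eq1 (x : N) e :
  ((x : circ_group B) ^+ (p ^ e) == 1)%g = (x ^+ (p ^ e) == 1)%g.
Proof.
pose V : finLmodType {poly R} := polymod (gamma_map x).
have mulnE n (v : V) : n%:R *: v = (v : N) *+ n by rewrite scaler_nat.
have pk0 (v : V) : (p ^ k)%:R *: v = 0.
  rewrite mulnE -N_card -cardsT; exact: (expg_cardG (in_setT (v : N))).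
(* X acts with p-power order because x^|N| is trivial in (N, o) *)
have gk (v : V) : 'X ^+ (p ^ k) *: v = v.
  rewrite polymodXn (iter_gamma x) -N_card.
  have -> : ((x : circ_group B) ^+ #|N|)%g = 1%g.
    by rewrite -cardsT; apply: (expg_cardG (in_setT (x : circ_group B))).
  by rewrite -[1%g]/(circ1 B) circ1_eq0 gamma0x.
have sub (A : {set V}) : submod_closed A -> submod_closed (A : {set N}).
  move=> [A0 AD]; split=> // a u v Au Av.
  by have := AD a%:P u v Au Av; rewrite polymodC.
have V_step (A C : {set V}) : submod_closed A -> submod_closed C ->
    A \proper C -> scaled p%:R C \subset A -> (q * #|A| <= #|C|)%N.
  move=> sA sC ltAC pCA; apply: card_step (sub _ sA) (sub _ sC) ltAC _.
  apply/subsetP => _ /imsetP[u Cu ->]; apply: (subsetP pCA); apply/imsetP.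
  by exists u; rewrite // !scaler_nat.
have V_torsion : (#|[set v : V | p%:R *: v == 0%R]| < q ^ (p - 1))%N.
  apply: leq_ltn_trans torsion_lt; apply/subset_leq_card/subsetP => v.
  by rewrite !inE mulnE.
have := geometric_sum_eq0 p_pr V_step V_torsion e (x : V) pk0 gk.
rewrite mulnE -(circ_expgE x) => <-.
by rewrite -[1%g]/(circ1 B) circ1_eq0.
Qed.

(** Both orders are powers of p, so it is enough to compare p^e-th powers. *)
Lemma circ_order (x : N) : #[x : circ_group B]%g = #[x]%g.
Proof.
have ppow (gT : finGroupType) (y : gT) : #|gT| = (p ^ k)%N -> exists e, #[y]%g = (p ^ e)%N.
  move=> gT_card; suff /p_natP[e ->] : p.-nat #[y]%g by exists e.
  apply: pnat_dvd (order_dvdG (in_setT y)) _.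
  by rewrite cardsT gT_card pnatX pnat_id.
have [a xa] := ppow _ (x : circ_group B) N_card.
have [b xb] := ppow _ x N_card.
apply/eqP; rewrite eqn_dvd; apply/andP; split.
  by rewrite order_dvdn xb circ_expg_eq1 -xb expg_order.
by rewrite order_dvdn xa -circ_expg_eq1 -xa expg_order.
Qed.

End ModuleBrace.

Theorem corollary4p6 (p : nat) (p_pr : prime p) (lambda : nat)
    (lambda_ge1 : 1 <= lambda)
    (L : fieldExtType (padic p_pr)) (L_deg : \dim {:L} = lambda)
    (L_unr : unramified L)
    (N : finLmodType (ring_of_integers L)) (B : brace N) (B_mod : module_brace B)
    (k : nat) (N_card : #|N| = p ^ k)
    (r : nat) (N_rank : has_rank [set: N]%G r) (r_lt : r < lambda * (p - 1)) :
  (forall n : nat,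
     #|[set x : N | #[x]%g == n]| = #|[set x : circ_group B | #[x]%g == n]|) /\
  (abelian [set: circ_group B] -> [set: N] \isog [set: circ_group B]).
Proof.
have N_pgroup (gT : finGroupType) : #|gT| = p ^ k -> (p.-group [set: gT])%g.
  by move=> gT_card; rewrite /pgroup cardsT gT_card pnatX pnat_id.
have torsion_lt : #|[set x : N | (x ^+ p)%g == 1%g]| < (p ^ lambda) ^ (p - 1).
  have [b [sz_b defN _]] := N_rank.
  have := card_p_torsion p_pr (N_pgroup _ N_card) (FinRing.zmod_abelian _) defN.
  rewrite sz_b => le_r; rewrite -expnM.
  apply: leq_ltn_trans (_ : p ^ r < _); last by rewrite ltn_exp2l ?prime_gt1.
  apply: leq_trans le_r; apply/subset_leq_card/subsetP => x.
  by rewrite !inE.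
have card_step := card_unramified_step L_unr N_card; rewrite L_deg in card_step.
have eq_order x := circ_order B_mod p_pr N_card card_step torsion_lt x.
have counts n :
    #|[set x : N | #[x]%g == n]| = #|[set x : circ_group B | #[x]%g == n]|.
  by apply: eq_card => x; rewrite !inE eq_order.
split=> // cBB.
apply: (isog_order_counts p_pr) cBB _; rewrite ?N_pgroup ?FinRing.zmod_abelian //.
move=> n; have := counts n; congr (_ = _); apply: eq_card => x;
  by rewrite !inE.
Qed.
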